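(* Let $v\in\mathbb{R}^n$, let $\mathscr{I}\subseteq\mathbb{R}$ be an interval, let $\{K_t\}_{t\in\mathscr{I}}$ and $\{L_t\}_{t\in\mathscr{I}}$ be linear parameter systems in $\mathbb{R}^n$ along the direction $v$, such that $K_t$ and $L_t$ contain the origin for every $t\in\mathscr{I}$, and let $p\ge 1$ be real. Then $\{K_t+_pL_t\}_{t\in\mathscr{I}}$ is also a linear parameter system along the direction $v$.
   Context: A convex body in $\mathbb{R}^n$ is a non-empty compact convex subset of $\mathbb{R}^n$; its support function is $h_K(u)=\sup\{\langle x,u\rangle : x\in K\}$, $u\in\mathbb{R}^n$. For a real number $p\ge 1$ and convex bodies $K,L\subset\mathbb{R}^n$ both containing the origin, the $p$-sum $K+_pL$ is the convex body whose support function is $h_{K+_pL}(u)=\big(h_K(u)^p+h_L(u)^p\big)^{1/p}$, $u\in\mathbb{R}^n$. A linear parameter system along the direction $v\in\mathbb{R}^n$ is a family $\{K_t\}_{t\in\mathscr{I}}$ of convex bodies in $\mathbb{R}^n$, indexed by an interval $\mathscr{I}\subseteq\mathbb{R}$, that can be written in the form $$K_t=\operatorname{conv}\{x_i+\lambda_i t v : i\in I\},\qquad t\in\mathscr{I},$$ where $I$ is an arbitrary index set, and $\{x_i\}_{i\in I}\subset\mathbb{R}^n$ and $\{\lambda_i\}_{i\in I}\subset\mathbb{R}$ are bounded (and do not depend on $t$). Here $\operatorname{conv}$ denotes the convex hull. Different linear parameter systems may use different index sets. *)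

(* Defs.v *)
From HB Require Import structures.
From mathcomp Require Import all_boot all_order all_algebra.
From mathcomp Require Import all_classical all_reals all_analysis.
Set Implicit Arguments.
Unset Strict Implicit.
Unset Printing Implicit Defensive.
Import Order.TTheory GRing.Theory Num.Theory.
Import numFieldNormedType.Exports.
Local Open Scope classical_set_scope.
Local Open Scope ring_scope.

(* R^n is 'rV[R]_n. Its library norm is the sup norm, which has the same
   compact sets and bounded families as the Euclidean norm. *)

Definition dot (R : realType) (n : nat) (x u : 'rV[R]_n) : R :=
  \sum_(i < n) x ord0 i * u ord0 i.

Definition convex_body (R : realType) (n : nat) (K : set 'rV[R]_n) : Prop :=
  [/\ K !=set0, compact K & convex_set K].

(* The real [sup] is 0 on sets that are empty or unbounded above; neither
   occurs when K is a convex body. *)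
Definition support_fun (R : realType) (n : nat) (K : set 'rV[R]_n)
    (u : 'rV[R]_n) : R :=
  sup [set dot x u | x in K].

(* Definite description: a convex body is determined by its support function.
   The default value set0 is not a convex body. *)
Definition psum (R : realType) (n : nat) (p : R) (K L : set 'rV[R]_n) :
    set 'rV[R]_n :=
  xget set0 [set M | convex_body M /\
    forall u, support_fun M u =
      (support_fun K u `^ p + support_fun L u `^ p) `^ p^-1].

Definition conv_hull (R : realType) (n : nat) (A : set 'rV[R]_n) :
    set 'rV[R]_n :=
  smallest (@convex_set R 'rV[R]_n) A.

(* The family K matters only on T; T may be open, closed, half-open, bounded
   or unbounded on either side. *)
Definition linear_parameter_system (R : realType) (n : nat) (v : 'rV[R]_n)
    (T : interval R) (K : R -> set 'rV[R]_n) : Prop :=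
  (forall t, t \in T -> convex_body (K t)) /\
  exists (J : Type) (x : J -> 'rV[R]_n) (lambda : J -> R),
    [/\ bounded_set (range x), bounded_set (range lambda) &
      forall t, t \in T ->
        K t = conv_hull (range (fun j => x j + (lambda j * t) *: v))].

(* Main.v *)
(* Let D be the set of (a, b) in the closed quadrant with
   a x + b y <= (x^p + y^p)^(1/p) for all x, y >= 0; Hoelder's inequality shows
   that the bound is attained. Hence {a x + b y : (a, b) in D, x in K, y in L},
   which is convex and compact because D is, has support function
   (h_K^p + h_L^p)^(1/p) when h_K, h_L >= 0, and a separation argument
   identifies it with the p-sum. If K = conv {x_i} and L = conv {y_j}, this set
   is conv {a x_i + b y_j}; as D does not depend on t, substituting
   x_i + lambda_i t v and y_j + mu_j t v exhibits the p-sums as a linear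
   parameter system with speeds a lambda_i + b mu_j. *)

Require Import Defs.
From HB Require Import structures.
From mathcomp Require Import all_boot all_order all_algebra.
From mathcomp Require Import all_classical all_reals all_analysis.
From mathcomp Require Import ring lra.
Set Implicit Arguments.
Unset Strict Implicit.
Unset Printing Implicit Defensive.
Import Order.TTheory GRing.Theory Num.Theory.
Import numFieldNormedType.Exports.
Local Open Scope classical_set_scope.
Local Open Scope ring_scope.

(** * Convex combinations and the dot product *)

Lemma convex_setP (R : realType) (V : lmodType R) (A : set V) :
  convex_set A <-> forall (x y : V) (k : R), 0 <= k -> k <= 1 -> A x -> A y ->
    A (k *: x + (1 - k) *: y).
Proof.
split=> [cA x y k k0 k1 Ax Ay | cA x y k].
  have := cA x y (Itv01 k0 k1); rewrite !inE; exact.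
by rewrite !inE => Ax Ay; apply: cA.
Qed.

(** Dividing by [a + b] leaves a convex combination; if [a + b = 0], both coefficients vanish. This
    yields convexity of [dual_sum], whose coefficients vary with the point. *)
Lemma convex_set_scaleD (R : realType) (V : lmodType R) (A : set V) (x y : V)
    (a b : R) : convex_set A -> A x -> A y -> 0 <= a -> 0 <= b ->
  exists2 z, A z & a *: x + b *: y = (a + b) *: z.
Proof.
move=> /convex_setP cA Ax Ay a0 b0.
have [ab0|abN0] := eqVneq (a + b) 0.
  exists x => //; have [-> ->] : a = 0 /\ b = 0 by lra.
  by rewrite addr0 !scale0r addr0.
exists ((a / (a + b)) *: x + (1 - a / (a + b)) *: y).
  have ab_gt0 : 0 < a + b by rewrite lt_neqAle eq_sym abN0 addr_ge0.
  apply: cA => //; first by rewrite divr_ge0 // ltW.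
  by rewrite ler_pdivrMr // mul1r lerDl.
rewrite scalerDr !scalerA; congr (_ *: _ + _ *: _); by field.
Qed.

Lemma dotDl (R : realType) (n : nat) (x y u : 'rV[R]_n) :
  dot (x + y) u = dot x u + dot y u.
Proof. by rewrite -big_split; apply: eq_bigr => i _; rewrite mxE mulrDl. Qed.

Lemma dotZl (R : realType) (n : nat) (a : R) (x u : 'rV[R]_n) :
  dot (a *: x) u = a * dot x u.
Proof. by rewrite /dot mulr_sumr; apply: eq_bigr => i _; rewrite mxE mulrA. Qed.

Lemma dotC (R : realType) (n : nat) (x y : 'rV[R]_n) : dot x y = dot y x.
Proof. by apply: eq_bigr => i _; rewrite mulrC. Qed.

Lemma dotDr (R : realType) (n : nat) (x u w : 'rV[R]_n) :
  dot x (u + w) = dot x u + dot x w.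
Proof. by rewrite dotC dotDl !(dotC x). Qed.

Lemma dotZr (R : realType) (n : nat) (a : R) (x u : 'rV[R]_n) :
  dot x (a *: u) = a * dot x u.
Proof. by rewrite dotC dotZl dotC. Qed.

Lemma dot_gt0 (R : realType) (n : nat) (x : 'rV[R]_n) : x != 0 -> 0 < dot x x.
Proof.
move=> x0; rewrite lt_neqAle sumr_ge0 => [|i _]; last exact: sqr_ge0.
rewrite andbT eq_sym; apply: contra x0; rewrite psumr_eq0 => [|i _]; last first.
  exact: sqr_ge0.
move=> /allP h; apply/eqP/rowP => i; rewrite mxE.
by have /eqP := h i (mem_index_enum i); move/eqP; rewrite mulf_eq0 orbb => /eqP.
Qed.

Lemma cvg_dot (R : realType) (n : nat) (S : Type) (F : set_system S)
    (f g : S -> 'rV[R]_n) (x y : 'rV[R]_n) : Filter F ->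
  f @ F --> x -> g @ F --> y -> dot (f s) (g s) @[s --> F] --> dot x y.
Proof.
move=> FF fx gy; apply: (@cvg_big R^o _ _ _ _ add_continuous) => i _.
apply: (@cvgM _ _ F); first exact: cvg_comp fx (@coord_continuous _ _ _ _ _ _).
exact: cvg_comp gy (@coord_continuous _ _ _ _ _ _).
Qed.

(** * Support functions and separation *)

Lemma support_fun_attained (R : realType) (n : nat) (K : set 'rV[R]_n)
    (u : 'rV[R]_n) : K !=set0 -> compact K ->
  exists2 x, K x &
    support_fun K u = dot x u /\ forall y, K y -> dot y u <= dot x u.
Proof.
move=> K0 cK.
have [|x] := compact_EVT_max K0 cK (f := fun x => dot x u).
  apply: continuous_subspaceT => x.
  exact: (@cvg_dot _ _ _ (nbhs x) id (fun=> u) x u _ cvg_id (cvg_cst _)).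
rewrite inE => Kx xmax; exists x => //.
have xub y : K y -> dot y u <= dot x u by move=> Ky; apply: xmax; rewrite inE.
split => //; apply/eqP; rewrite eq_le ge_sup /=; last 2 first.
- by exists (dot x u), x.
- by move=> _ [y Ky <-]; exact: xub.
apply: ub_le_sup; last by exists x.
by exists (dot x u) => _ [y Ky <-]; exact: xub.
Qed.

Lemma dot_le_support_fun (R : realType) (n : nat) (K : set 'rV[R]_n)
    (x u : 'rV[R]_n) : compact K -> K x -> dot x u <= support_fun K u.
Proof.
move=> cK Kx.
by have [|y _ [-> +]] := support_fun_attained (K := K) u _ cK; [exists x|exact].
Qed.

(* The separating direction points from the nearest point of [K] to [z]. *)
Lemma convex_body_separation (R : realType) (n : nat) (K : set 'rV[R]_n)
    (z : 'rV[R]_n) : convex_body K -> ~ K z ->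
  exists u, support_fun K u < dot z u.
Proof.
move=> [K0 cK /convex_setP kK] nKz.
have [|x] := compact_EVT_min K0 cK
    (f := fun x : 'rV[R]_n => dot (x - z) (x - z)).
  apply: continuous_subspaceT => x.
  have xz : (y : 'rV[R]_n) - z @[y --> x] --> x - z.
    exact: (@cvgB _ _ _ (nbhs x) _ id (fun=> z) x z cvg_id (cvg_cst _)).
  exact: (@cvg_dot _ _ _ (nbhs x) _ _ _ _ _ xz xz).
rewrite inE => Kx xmin; exists (z - x).
have zx0 : z - x != 0.
  by apply: contra_notN nKz; rewrite subr_eq0 => /eqP ->.
have [y Ky [-> _]] := support_fun_attained (z - x) K0 cK.
set w := z - x.
suff : dot (y - x) w <= 0.
  have := dot_gt0 zx0; rewrite -/w.
  have -> : dot y w = dot (y - x) w + dot x w by rewrite -dotDl subrK.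
  have -> : dot z w = dot w w + dot x w by rewrite -dotDl subrK.
  lra.
set d := y - x.
(* Moving from the nearest point [x] towards [y] cannot bring it closer to [z]; expanding the
   squared distances leaves a first-order and a second-order term in [k]. *)
have step k : 0 <= k -> k <= 1 -> 2 * k * dot d w <= k ^+ 2 * dot d d.
  move=> k0 k1; have := xmin (k *: y + (1 - k) *: x).
  rewrite inE => /(_ (kK _ _ _ k0 k1 Ky Kx)).
  have -> : k *: y + (1 - k) *: x - z = k *: d + (-1) *: w.
    by apply/rowP => i; rewrite !mxE; ring.
  have -> : x - z = (-1) *: w by rewrite scaleN1r opprB.
  move: d w => d w; rewrite !(dotDl, dotZl, dotDr, dotZr) (dotC w d); lra.
rewrite leNgt; apply/negP => dw.
have dd : 0 <= dot d d by apply: sumr_ge0 => i _; exact: sqr_ge0.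
(* This [k] is at most 1 and satisfies [k * dot d d < dot d w], whereas [step] divided by [k] gives
   [2 * dot d w <= k * dot d d]. *)
pose k := dot d w / (dot d w + dot d d).
have D0 : 0 < dot d w + dot d d by lra.
have k0 : 0 < k by apply: divr_gt0.
have k1 : k <= 1 by rewrite ler_pdivrMr //; lra.
have kE : k * (dot d w + dot d d) = dot d w by rewrite divfK // gt_eqF.
clearbody k; have := step k (ltW k0) k1.
rewrite expr2 -!mulrA mulrCA ler_pM2l //.
have := mulr_gt0 k0 dw; move: kE; rewrite mulrDr; lra.
Qed.

(** A point of one body outside the other would be separated from it, so the first support function
    would be larger in that direction. *)
Lemma support_fun_inj (R : realType) (n : nat) (K L : set 'rV[R]_n) :
  convex_body K -> convex_body L -> support_fun K =1 support_fun L -> K = L.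
Proof.
have sub A B : convex_body A -> convex_body B ->
    support_fun A =1 support_fun B -> A `<=` B.
  move=> [_ cA _] bB AB x Ax; apply: contrapT => /(convex_body_separation bB).
  by case=> u; rewrite -AB ltNge dot_le_support_fun.
by move=> bK bL KL; apply/seteqP; split; apply: sub => // u; rewrite KL.
Qed.

(** * The dual quadrant and Hoelder's inequality *)

(* For [p > 1] this is the part [a^q + b^q <= 1] of the quadrant, with [q] the
   conjugate exponent, and for [p = 1] it is the unit square. *)
Definition dual_quadrant (R : realType) (p : R) : set (R * R) :=
  [set c | [/\ 0 <= c.1, 0 <= c.2 & forall x y, 0 <= x -> 0 <= y ->
    c.1 * x + c.2 * y <= (x `^ p + y `^ p) `^ p^-1]].

Definition dual_sum (R : realType) (n : nat) (p : R) (K L : set 'rV[R]_n) :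
    set 'rV[R]_n :=
  [set c.1.1 *: c.2.1 + c.1.2 *: c.2.2 | c in dual_quadrant p `*` (K `*` L)].

Lemma dual_quadrant_le1 (R : realType) (p : R) (c : R * R) : 0 < p ->
  dual_quadrant p c -> c.1 <= 1 /\ c.2 <= 1.
Proof.
move=> p0 [c1 c2 h]; have pN0 : p != 0 by rewrite gt_eqF.
split; [have := h 1 0 ler01 (lexx 0)|have := h 0 1 (lexx 0) ler01];
  by rewrite mulr0 mulr1 powR1 powR0 // ?addr0 ?add0r powR1.
Qed.

(** It is an intersection of closed half-planes, contained in the unit square. *)
Lemma dual_quadrant_compact (R : realType) (p : R) : 0 < p ->
  compact (dual_quadrant p).
Proof.
move=> p0.
apply: (@subclosed_compact (R * R)%type _ ([set` `[0, 1]] `*` [set` `[0, 1]])).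
- have -> : dual_quadrant p = [set c | 0 <= c.1] `&` [set c | 0 <= c.2] `&`
      \bigcap_(z in [set z : R * R | 0 <= z.1 /\ 0 <= z.2])
        [set c | c.1 * z.1 + c.2 * z.2 <= (z.1 `^ p + z.2 `^ p) `^ p^-1].
    apply/seteqP; split=> [c [c1 c2 h]|c [[c1 c2] h]]; split => //.
      by move=> [x y] /= [x0 y0]; exact: h.
    by move=> x y x0 y0; exact: (h (x, y)).
  apply: closedI; first apply: closedI.
  + apply: (@preimage_closed _ _ fst [set x : R | 0 <= x]).
      by move=> x _; exact: cvg_fst.
    exact: closed_ge.
  + apply: (@preimage_closed _ _ snd [set x : R | 0 <= x]).
      by move=> x _; exact: cvg_snd.
    exact: closed_ge.
  apply: closed_bigI => z _.
  apply: (@preimage_closed _ _ (fun c : R * R => c.1 * z.1 + c.2 * z.2)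
    [set x : R | x <= _]); last exact: closed_le.
  move=> c _; apply: (@cvgD _ R^o _ (nbhs c)).
    exact: (@cvgM _ _ (nbhs c) _ fst (fun=> z.1) _ _ cvg_fst (cvg_cst _)).
  exact: (@cvgM _ _ (nbhs c) _ snd (fun=> z.2) _ _ cvg_snd (cvg_cst _)).
- by apply: compact_setX; exact: segment_compact.
- move=> c Dc; have [c1 c2] := dual_quadrant_le1 p0 Dc.
  by case: Dc => h1 h2 _; split; rewrite /= in_itv /= ?h1 ?h2.
Qed.

Lemma dual_quadrant_convex (R : realType) (p : R) (c d : R * R) (k : R) :
  0 <= k -> k <= 1 -> dual_quadrant p c -> dual_quadrant p d ->
  dual_quadrant p (k * c.1 + (1 - k) * d.1, k * c.2 + (1 - k) * d.2).
Proof.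
move=> k0 k1 [c1 c2 hc] [d1 d2 hd]; have k1' : 0 <= 1 - k by rewrite subr_ge0.
split=> /= [||x y x0 y0]; try by rewrite addr_ge0 // mulr_ge0.
have := lerD (ler_wpM2l k0 (hc x y x0 y0)) (ler_wpM2l k1' (hd x y x0 y0)).
by rewrite -mulrDl subrKC mul1r; apply: le_trans; lra.
Qed.

(** Hoelder with exponents [p / (p - 1)] and [p]: raising the coefficients to the conjugate exponent
    gives back the [p]-th powers of [s] and [t], so their factor is 1. *)
Lemma dual_quadrant_powR (R : realType) (p s t : R) : 1 < p ->
  0 <= s -> 0 <= t -> s `^ p + t `^ p = 1 ->
  dual_quadrant p (s `^ (p - 1), t `^ (p - 1)).
Proof.
move=> p1 s0 t0 stE; split=> /= [||z w z0 w0]; try exact: powR_ge0.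
have p0 : 0 < p by lra.
have p10 : 0 < p - 1 by lra.
have q0 : 0 < p / (p - 1) by rewrite divr_gt0.
have pq : (p / (p - 1))^-1 + p^-1 = 1 by field; rewrite !gt_eqF.
have powq r : (r `^ (p - 1)) `^ (p / (p - 1)) = r `^ p.
  by rewrite -powRrM mulrCA divff ?mulr1 // gt_eqF.
have := hoelder2 (powR_ge0 s (p - 1)) (powR_ge0 t (p - 1)) z0 w0 q0 p0 pq.
by rewrite (powq s) (powq t) stE powR1 mul1r.
Qed.

(** For [p > 1] and a nonzero point, the maximiser is the gradient of the p-norm, which is the
    equality case of Hoelder. *)
Lemma dual_quadrant_attained (R : realType) (p x y : R) : 1 <= p ->
  0 <= x -> 0 <= y ->
  exists2 c, dual_quadrant p c & c.1 * x + c.2 * y = (x `^ p + y `^ p) `^ p^-1.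
Proof.
(* At [p = 1] there is no finite conjugate exponent; the corner of the unit square serves
   instead. *)
rewrite le_eqVlt => /predU1P[<-|p1] x0 y0.
  exists (1, 1) => /=; last by rewrite invr1 !powRr1 ?addr_ge0 // !mul1r.
  by split=> //= z w z0 w0; rewrite invr1 !powRr1 ?addr_ge0 // !mul1r.
have p0 : 0 < p by lra.
have pN0 : p != 0 by rewrite gt_eqF.
have pow_pinvK z : 0 <= z -> (z `^ p^-1) `^ p = z.
  by move=> z0; rewrite -powRrM mulVf // powRr1.
set S := x `^ p + y `^ p; have S0 : 0 <= S by rewrite addr_ge0 // powR_ge0.
(* Normalising by [N] requires [S] to be nonzero; otherwise the right side is 0 and the zero
   coefficients attain it. *)
set N := S `^ p^-1; have [SE|SN0] := eqVneq S 0.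
  exists (0, 0); last by rewrite /N SE powR0 ?invr_eq0 //= !mul0r addr0.
  by split=> //= z w _ _; rewrite !mul0r addr0 powR_ge0.
have N0 : 0 < N by rewrite powR_gt0 // lt_neqAle eq_sym SN0.
have NN0 : N != 0 by rewrite gt_eqF.
pose s := x / N; pose t := y / N.
have s0 : 0 <= s by rewrite divr_ge0 // ltW.
have t0 : 0 <= t by rewrite divr_ge0 // ltW.
have stE : s `^ p + t `^ p = 1.
  apply: (mulIf SN0); rewrite mul1r mulrDl -{1 2}[S]pow_pinvK // -/N.
  by rewrite -!powRM // ?ltW // !divfK.
have xE : x = s * N by rewrite divfK.
have yE : y = t * N by rewrite divfK.
exists (s `^ (p - 1), t `^ (p - 1)); first exact: dual_quadrant_powR.
have powB1 z : 0 <= z -> z `^ (p - 1) * z = z `^ p.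
  by move=> z0; rewrite mulrC mulr_powRB1.
clearbody s t; clearbody N => /=.
by rewrite xE yE !mulrA !powB1 // -mulrDl stE mul1r.
Qed.

(** * The dual sum as the p-sum *)

Lemma dual_sum_convex_body (R : realType) (n : nat) (p : R)
    (K L : set 'rV[R]_n) : 0 < p ->
  convex_body K -> convex_body L -> convex_body (dual_sum p K L).
Proof.
move=> p0 [[x Kx] cK kK] [[y Ly] cL kL]; split.
- exists (0 *: x + 0 *: y), ((0, 0), (x, y)) => //; split => //.
  by split=> //= z w _ _; rewrite !mul0r addr0 powR_ge0.
- apply: continuous_compact; last first.
    by apply: compact_setX; [exact: dual_quadrant_compact|exact: compact_setX].
  apply: continuous_subspaceT => c.
  have f1 : (z : (R * R) * ('rV[R]_n * 'rV[R]_n)).1.1 @[z --> nbhs c] --> c.1.1.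
    apply: (@cvg_comp _ _ _ fst fst _ (nbhs c.1)); [exact: cvg_fst|].
    exact: cvg_fst.
  have f2 : (z : (R * R) * ('rV[R]_n * 'rV[R]_n)).1.2 @[z --> nbhs c] --> c.1.2.
    apply: (@cvg_comp _ _ _ fst snd _ (nbhs c.1)); [exact: cvg_fst|].
    exact: cvg_snd.
  have f3 : (z : (R * R) * ('rV[R]_n * 'rV[R]_n)).2.1 @[z --> nbhs c] --> c.2.1.
    apply: (@cvg_comp _ _ _ snd fst _ (nbhs c.2)); [exact: cvg_snd|].
    exact: cvg_fst.
  have f4 : (z : (R * R) * ('rV[R]_n * 'rV[R]_n)).2.2 @[z --> nbhs c] --> c.2.2.
    apply: (@cvg_comp _ _ _ snd snd _ (nbhs c.2)); [exact: cvg_snd|].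
    exact: cvg_snd.
  exact: (cvgD (cvgZ f1 f3) (cvgZ f2 f4)).
- apply/convex_setP => _ _ k k0 k1 [c [Dc [Kc Lc]] <-] [d [Dd [Kd Ld]] <-].
  have k1' : 0 <= 1 - k by rewrite subr_ge0.
  have [c1 c2 _] := Dc; have [d1 d2 _] := Dd.
  have [x' Kx' xE] := convex_set_scaleD kK Kc Kd
    (mulr_ge0 k0 c1) (mulr_ge0 k1' d1).
  have [y' Ly' yE] := convex_set_scaleD kL Lc Ld
    (mulr_ge0 k0 c2) (mulr_ge0 k1' d2).
  exists ((k * c.1.1 + (1 - k) * d.1.1, k * c.1.2 + (1 - k) * d.1.2), (x', y')).
    by split; [exact: dual_quadrant_convex|split].
  by rewrite /= -xE -yE !scalerDr !scalerA addrACA.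
Qed.

Lemma support_fun_ge0 (R : realType) (n : nat) (K : set 'rV[R]_n)
    (u : 'rV[R]_n) : compact K -> K 0 -> 0 <= support_fun K u.
Proof.
move=> cK K0; have := dot_le_support_fun u cK K0.
by rewrite -{1}(scale0r (0 : 'rV[R]_n)) dotZl mul0r.
Qed.

(** The upper bound is the inequality defining [dual_quadrant], tested at the two support values,
    which are nonnegative because the bodies contain 0. The lower bound combines optimal
    coefficients with maximisers in [K] and [L]. *)
Lemma support_fun_dual_sum (R : realType) (n : nat) (p : R)
    (K L : set 'rV[R]_n) (u : 'rV[R]_n) : 1 <= p ->
  convex_body K -> convex_body L -> K 0 -> L 0 ->
  support_fun (dual_sum p K L) u =
    (support_fun K u `^ p + support_fun L u `^ p) `^ p^-1.
Proof.
move=> p1 bK bL K0 L0; have p0 : 0 < p by lra.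
have [KL0 cKL _] := dual_sum_convex_body p0 bK bL.
case: bK bL => [K_0 cK _] [L_0 cL _].
have [hK0 hL0] := (support_fun_ge0 u cK K0, support_fun_ge0 u cL L0).
apply/eqP; rewrite eq_le; apply/andP; split.
  have [_ [c [Dc [Kc Lc]] <-] [-> _]] := support_fun_attained u KL0 cKL.
  case: Dc => c1 c2 /(_ _ _ hK0 hL0); apply: le_trans.
  by rewrite dotDl !dotZl lerD // ler_wpM2l // dot_le_support_fun.
have [c Dc <-] := dual_quadrant_attained p1 hK0 hL0.
have [x Kx [-> _]] := support_fun_attained u K_0 cK.
have [y Ly [-> _]] := support_fun_attained u L_0 cL.
rewrite -!dotZl -dotDl; apply: dot_le_support_fun => //.
by exists (c, (x, y)).
Qed.

Lemma psumE (R : realType) (n : nat) (p : R) (K L : set 'rV[R]_n) : 1 <= p ->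
  convex_body K -> convex_body L -> K 0 -> L 0 -> psum p K L = dual_sum p K L.
Proof.
move=> p1 bK bL K0 L0; apply: xget_subset1.
  split; first by apply: dual_sum_convex_body => //; lra.
  by move=> u; exact: support_fun_dual_sum.
move=> A B [bA hA] [bB hB]; apply: support_fun_inj => // u.
by rewrite hA hB.
Qed.

(** * Generators and boundedness of the dual sum *)

Lemma conv_hull_ind (R : realType) (n : nat) (A C : set 'rV[R]_n) :
  (forall (x y : 'rV[R]_n) (k : R), 0 <= k -> k <= 1 -> C x -> C y ->
    C (k *: x + (1 - k) *: y)) ->
  A `<=` C -> conv_hull A `<=` C.
Proof. by move=> cC AC; apply: smallest_sub => //; exact/convex_setP. Qed.

(** For fixed coefficients the combination is affine in each of the two points, so hull induction
    applies to one point at a time. *)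
Lemma dual_sum_conv_hull (R : realType) (n : nat) (p : R) (I J : Type)
    (x : I -> 'rV[R]_n) (y : J -> 'rV[R]_n) : 0 < p ->
  convex_body (conv_hull (range x)) -> convex_body (conv_hull (range y)) ->
  dual_sum p (conv_hull (range x)) (conv_hull (range y)) =
  conv_hull (range (fun s : {c | dual_quadrant p c} * (I * J) =>
    (sval s.1).1 *: x s.2.1 + (sval s.1).2 *: y s.2.2)).
Proof.
move=> p0 bx b_y; apply/seteqP; split; last first.
  apply: smallest_sub; first by case: (dual_sum_convex_body p0 bx b_y).
  move=> _ [[[c Dc] [i j]] _ <-]; exists (c, (x i, y j)) => //.
  by split=> //; split; apply: sub_gen_smallest; [exists i|exists j].
move=> _ [[c [z w]] [/= Dc [/= xz yw]] <-] C /= [/convex_setP cC gC].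
(* Here [C] is any convex set containing the generators; [w] stays quantified while [z] is reduced
   to some [x i]. *)
move: z xz w yw; apply: conv_hull_ind => [z z' k k0 k1 hz hz' w yw|_ [i _ <-]].
  have -> : c.1 *: (k *: z + (1 - k) *: z') + c.2 *: w =
      k *: (c.1 *: z + c.2 *: w) + (1 - k) *: (c.1 *: z' + c.2 *: w).
    by apply/rowP => l; rewrite !mxE; ring.
  by apply: cC => //; [exact: hz|exact: hz'].
apply: conv_hull_ind => [w w' k k0 k1 hw hw'|_ [j _ <-]].
  have -> : c.1 *: x i + c.2 *: (k *: w + (1 - k) *: w') =
      k *: (c.1 *: x i + c.2 *: w) + (1 - k) *: (c.1 *: x i + c.2 *: w').
    by apply/rowP => l; rewrite !mxE; ring.
  exact: cC.
by apply: gC; exists (exist _ c Dc, (i, j)).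
Qed.

Lemma bounded_rangeP (R : realType) (V : normedModType R) (I : Type)
    (f : I -> V) : bounded_set (range f) <-> exists M, forall i, `|f i| <= M.
Proof.
split=> [[M [_ h]]|[M h]].
  (* [bounded_set] only promises bounds strictly above [M]. *)
  by exists (M + 1) => i; apply: (h (M + 1)); [rewrite ltrDl|exists i].
exists M; split=> [|N MN _ [i _ <-]]; [exact: num_real|].
exact: le_trans (ltW MN).
Qed.

(** Both coefficients lie in [[0, 1]]. The space [V] is general so that the lemma covers base points
    and speeds alike. *)
Lemma bounded_dual_sum (R : realType) (V : normedModType R) (p : R)
    (I J : Type) (f : I -> V) (g : J -> V) : 0 < p ->
  bounded_set (range f) -> bounded_set (range g) ->
  bounded_set (range (fun s : {c | dual_quadrant p c} * (I * J) =>
    (sval s.1).1 *: f s.2.1 + (sval s.1).2 *: g s.2.2)).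
Proof.
move=> p0 /bounded_rangeP[M fM] /bounded_rangeP[N gN]; apply/bounded_rangeP.
exists (M + N) => -[[c Dc] [i j]] /=.
have [c1 c2] := dual_quadrant_le1 p0 Dc; have [c1' c2' _] := Dc.
apply: le_trans (ler_normD _ _) _; rewrite !normrZ !ger0_norm //.
by apply: lerD; [apply: le_trans (fM i)|apply: le_trans (gN j)];
  rewrite ler_piMl.
Qed.

Unset Implicit Arguments.

Theorem theorem2p3 (R : realType) (n : nat) (v : 'rV[R]_n) (T : interval R)
    (K L : R -> set 'rV[R]_n) (p : R)
    (hK : linear_parameter_system v T K)
    (hL : linear_parameter_system v T L)
    (hK0 : forall t, t \in T -> K t 0)
    (hL0 : forall t, t \in T -> L t 0)
    (hp : 1 <= p) :
  linear_parameter_system v T (fun t => psum p (K t) (L t)).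
Proof.
have p0 : 0 < p by lra.
case: hK hL => bK [I [x [lam [bx blam KE]]]] [bL [J [y [mu [b_y bmu LE]]]]].
have psE t : t \in T -> psum p (K t) (L t) = dual_sum p (K t) (L t).
  by move=> tT; exact: psumE hp (bK t tT) (bL t tT) (hK0 t tT) (hL0 t tT).
split=> [t tT|]; first by rewrite psE //;
  exact: dual_sum_convex_body p0 (bK t tT) (bL t tT).
(* The coefficient pair is part of the index, so one index set independent of [t] serves all
   p-sums. *)
exists ({c | dual_quadrant p c} * (I * J))%type,
  (fun s => (sval s.1).1 *: x s.2.1 + (sval s.1).2 *: y s.2.2),
  (fun s => (sval s.1).1 * lam s.2.1 + (sval s.1).2 * mu s.2.2); split.
- exact: bounded_dual_sum.
(* Over [R^o] scaling is multiplication, which matches the speeds. *)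
- exact: (@bounded_dual_sum _ R^o).
- move=> t tT; move: (bK t tT) (bL t tT); rewrite psE // KE // LE // => bKt bLt.
  rewrite dual_sum_conv_hull //; congr conv_hull.
  by apply: eq_imagel => s _; apply/rowP => l; rewrite !mxE; ring.
Qed.
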